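(* Let $p$ be a prime number. There exist integers $a$ and $b$ such that $p=a^2+ab+b^2$ if and only if $p=3$ or $p\equiv 1 \pmod{3}$. *)

(* Defs.v *)
From mathcomp Require Export all_boot all_order all_algebra.

(* Main.v *)
Require Import Defs.
From mathcomp Require Import all_boot all_order all_algebra.
From mathcomp Require Import finfield zify ring.
Import GRing.Theory.
Local Open Scope ring_scope.

(** A value of the form is congruent to [(a - b)^2] modulo 3, which settles one
    direction. Conversely, if [p = 1 %[mod 3]] then ['F_p] contains a primitive
    cube root of unity [x]. By pigeonhole (Thue), [a = x b] in ['F_p] for some
    integers [a], [b] not both zero with [a^2, b^2 < p]; then [p] divides
    [a^2 + a b + b^2], which lies strictly between [0] and [3 p]. It is not
    [2 p], because an even value of the form is divisible by 4. *)

(** With [m = (p - 1) / 3], the polynomial [X^m - 1] has at most [m] roots, fewer than the [3 m]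
    nonzero elements; any nonzero [y] that is not a root gives the solution [y ^+ m]. *)
Lemma Fp_root_cyclotomic3 (p : nat) :
  prime p -> p = 1 %[mod 3] -> exists x : 'F_p, x ^+ 2 + x + 1 = 0.
Proof.
move=> p_pr p1; have p_gt1 := prime_gt1 p_pr.
pose m := (p.-1 %/ 3)%N.
have p_eq : p.-1 = (m * 3)%N by rewrite /m; lia.
have m_gt0 : (0 < m)%N by lia.
have [y y_neq0 ym_neq1] : exists2 y : 'F_p, y != 0 & y ^+ m != 1.
  apply/exists_inP; apply: contraT; rewrite negb_exists_in => /forall_inP ally.
  have roots : all (root ('X^m - 1%:P : {poly 'F_p})) (enum [set~ 0 : 'F_p]).
    apply/allP=> y; rewrite mem_enum !inE => /ally/negPn/eqP ym1.
    by rewrite rootE !hornerE ym1 subrr.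
  have poly_neq0 : 'X^m - 1%:P != 0 :> {poly 'F_p}.
    by rewrite -size_poly_eq0 size_XnsubC.
  have := max_poly_roots poly_neq0 roots (enum_uniq _).
  by rewrite -cardE cardsC1 card_Fp // size_XnsubC //; lia.
have ym3 : (y ^+ m) ^+ 3 = 1.
  apply: (mulfI y_neq0).
  rewrite -exprM -p_eq -exprS prednK ?prime_gt0 // mulr1.
  by have := expf_card y; rewrite card_Fp.
(* For [z = y ^+ m], cancel [z - 1] in [(z - 1) (z^2 + z + 1) = z^3 - 1 = 0]. *)
exists (y ^+ m); apply: (mulfI (x := y ^+ m - 1)); first by rewrite subr_eq0.
by rewrite mulr0 -(subrr 1) -{3}ym3; ring.
Qed.

(** The [(k + 1)^2] pairs [(u, v)] outnumber ['F_p], so [u - x v] takes some value twice; [a] and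
    [b] are the coordinate differences of the two pairs. *)
Lemma thue_Fp (p k : nat) (x : 'F_p) : prime p -> (p < k.+1 ^ 2)%N ->
  exists a b : int, [/\ (a != 0) || (b != 0), `|a| <= k%:Z, `|b| <= k%:Z &
                        a%:~R = x * b%:~R :> 'F_p].
Proof.
move=> p_pr p_lt.
pose f (uv : 'I_k.+1 * 'I_k.+1) : 'F_p := (uv.1 : nat)%:R - x * (uv.2 : nat)%:R.
have /injectivePn[[u v] [[u' v'] neq_uv eq_f]] : ~~ injectiveb f.
  apply/injectiveP => /leq_card; rewrite card_prod card_ord card_Fp //.
  by rewrite mulnn leqNgt p_lt.
exists (u%:Z - u'%:Z), (v%:Z - v'%:Z); split.
- apply: contraR neq_uv; rewrite negb_or !negbK => /andP[u0 v0].
  by rewrite xpair_eqE -!val_eqE /=; lia.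
- by have := ltn_ord u; have := ltn_ord u'; lia.
- by have := ltn_ord v; have := ltn_ord v'; lia.
move/(canRL (subrK _)): eq_f => /= eq_u.
by rewrite !rmorphB /= -!pmulrn eq_u /f /=; ring.
Qed.

(** The form is odd unless [a] and [b] are both even, and then 4 divides it. *)
Lemma dvdz2_half_form (a b m : int) :
  a ^+ 2 + a * b + b ^+ 2 = 2 * m -> (2 %| m)%Z.
Proof.
move=> N_eq.
have a_div : a = 2 * (a %/ 2)%Z + (a %% 2)%Z by lia.
have b_div : b = 2 * (b %/ 2)%Z + (b %% 2)%Z by lia.
have [] : (a %% 2)%Z = 0 \/ (a %% 2)%Z = 1 by lia.
all: have [] : (b %% 2)%Z = 0 \/ (b %% 2)%Z = 1 by lia.
all: move=> rb ra; rewrite ra in a_div; rewrite rb in b_div.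
all: rewrite a_div b_div in N_eq; clear ra rb a_div b_div.
all: by move: (a %/ 2)%Z (b %/ 2)%Z N_eq => c d N_eq; nia.
Qed.

Lemma form_mod3 (p : nat) (a b : int) :
  p%:Z = a ^+ 2 + a * b + b ^+ 2 -> ~~ (3 %| p)%N -> p = 1 %[mod 3].
Proof.
move=> p_eq p3.
have {p_eq} : p%:Z = (a - b) ^+ 2 + 3 * (a * b) by rewrite p_eq; ring.
move: (a - b) (a * b) => d c p_eq.
have d_div : d = 3 * (d %/ 3)%Z + (d %% 3)%Z by lia.
have [r|[r|r]] : (d %% 3)%Z = 0 \/ (d %% 3)%Z = 1 \/ (d %% 3)%Z = 2 by lia.
all: rewrite r in d_div; rewrite d_div in p_eq; clear r d_div.
all: by move: (d %/ 3)%Z p_eq => e p_eq; nia.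
Qed.

Theorem theoremA (p : nat) (hp : prime p) :
  (exists a b : int, p%:Z = a ^+ 2 + a * b + b ^+ 2) <->
  (p = 3%N \/ p = 1 %[mod 3]).
Proof.
split=> [[a [b p_eq]] | [-> | p1]]; last 2 first.
- by exists 1, 1.
- have [x x_root] := Fp_root_cyclotomic3 p hp p1.
  (* The least such [k] is the integer part of the square root of [p]. *)
  have exk : exists k, (p < k.+1 ^ 2)%N by exists p; nia.
  case: (ex_minnP exk) => k p_lt k_min.
  (* Equality fails since a prime is not a square; strictness yields the bound [3 p] below. *)
  have k2_lt : (k ^ 2 < p)%N.
    rewrite ltn_neqAle; apply/andP; split.
      apply: contraTneq hp => <-; apply/primeP => -[k2_gt1 /(_ k)].
      by rewrite dvdn_exp // => /(_ isT); nia.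
    case: k k_min {p_lt} => [|k] k_min; first by lia.
    by rewrite leqNgt; apply/negP => /k_min; rewrite ltnn.
  have [a [b [ab_neq0 a_le b_le ab]]] := thue_Fp p k x hp p_lt.
  have : (p %| a ^+ 2 + a * b + b ^+ 2)%Z.
    rewrite (dvdz_pcharf (pchar_Fp hp)); apply/eqP.
    (* Substituting [a = x b] turns the form into [b^2 (x^2 + x + 1)]. *)
    rewrite !rmorphD rmorphM !rmorphXn /= ab -[RHS](mulr0 (b%:~R ^+ 2)) -x_root.
    by ring.
  move=> /dvdzP[q N_eq].
  have N_gt0 : 0 < a ^+ 2 + a * b + b ^+ 2 by nia.
  have N_lt : a ^+ 2 + a * b + b ^+ 2 < 3 * p%:Z by nia.
  have q_bounds : 0 < q < 3 by nia.
  have [q1|q2] : q = 1 \/ q = 2 by lia.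
    by exists a, b; rewrite N_eq q1 mul1r.
  have p_even : (2 %| p)%N by rewrite q2 in N_eq; apply: dvdz2_half_form N_eq.
  have p2 : p = 2%N by apply/esym/eqP; rewrite -dvdn_prime2.
  by rewrite p2 in p1.
have [p3|p3] := boolP (3 %| p)%N.
  by left; apply/esym/eqP; rewrite -dvdn_prime2.
by right; apply: form_mod3 p_eq p3.
Qed.
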